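(* There is a universal constant $c>0$ such that for all integers $m\ge 2$ and $n\ge 1$ the following holds. Let $\mathcal{A}$ be a deterministic clock synchronization algorithm that is correct on every connected unit disk graph with $m$ vertices with uncertainty parameter $n$. Then there exist a connected $m$-vertex unit disk graph (with processors assigned to its vertices) and wake-up times in $\{0,1,\dots,n\}$ such that, in the resulting execution of $\mathcal{A}$, the sum over all processors of their radio use is at least $c\, m\sqrt{n}$. Consequently the energy efficiency of $\mathcal{A}$ on unit disk graphs is $\Omega(\sqrt{n})$ both when it is defined as the worst-case maximum radio use of a processor and when it is defined as the worst-case average radio use over the processors.
   Context: A unit disk graph is a graph whose vertices are placed at points of the Euclidean plane, all having the same transmission radius $r>0$, two distinct vertices being adjacent if and only if their distance is at most $r$. Model. A network is an undirected graph $G=(V,E)$ with $m$ vertices, the processors, which carry distinct identities $1,\dots,m$. Global time is divided into discrete time units $0,1,2,\dots$ and is not available to the processors. Processor $i$ wakes up at the beginning of global time unit $t_i\in\{0,1,\dots,n\}$. The $t_i$ are chosen arbitrarily and are unknown to the processors; the uncertainty parameter $n$ (and $m$) are known to all processors, but the graph $G$ is not. In each time unit after wake-up a processor's radio is either on or off (before wake-up it is off). If in a global time unit the radios of two adjacent processors are both on, each receives the message sent by the other in that time unit; a processor receives the messages of all its neighbours whose radios are on (there is no interference). Processors that are not adjacent cannot communicate directly. If its radio is off, a processor neither sends nor receives. A deterministic algorithm decides for each processor, as a deterministic function of $n$, $m$, the identity of the processor, the number of time units since its own wake-up, and all messages received in earlier time units, whether the radio is on in the current time unit; the content of messages is likewise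 determined by the information available to the processor. A clock synchronization algorithm is correct on $G$ if for all wake-up times $t_1,\dots,t_m\in\{0,1,\dots,n\}$ its execution contains a global time unit in which the radios of all $m$ processors are simultaneously on (and the processors synchronize their clocks in it). The radio use of a processor in an execution is the number of time units during which its radio is on. The energy efficiency of an algorithm is considered in two scenarios: (first) the maximum radio use of a processor, in the worst case; (second) the average over the processors of their radio use, in the worst case. *)

(* Defs.v *)
From mathcomp Require Import all_boot all_order all_algebra.
From mathcomp Require Import all_classical all_reals ereal topology normedtype sequences.

Set Implicit Arguments.
Unset Strict Implicit.
Unset Printing Implicit Defensive.

Import Order.TTheory GRing.Theory Num.Theory.

Local Open Scope classical_set_scope.
Local Open Scope ring_scope.

Definition euclidean_dist (R : realType) (p q : R * R) : R :=
  Num.sqrt ((p.1 - q.1) ^+ 2 + (p.2 - q.2) ^+ 2).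

(* The vertices are the processors themselves, so ranging over all relations on
   'I_m also ranges over all assignments of processors to vertices.  Nothing
   requires the points to be distinct: co-located vertices are adjacent, and
   spreading them out (after a small increase of r) yields the same graphs. *)
Definition unit_disk_graph (R : realType) (m : nat) (e : rel 'I_m) : Prop :=
  exists (r : R) (pos : 'I_m -> R * R), 0 < r /\
    forall i j : 'I_m,
      e i j = (i != j) && (euclidean_dist (pos i) (pos j) <= r).

Definition connected_graph (m : nat) (e : rel 'I_m) : Prop :=
  forall i j : 'I_m, connect e i j.

Definition connected_udg (R : realType) (m : nat) (e : rel 'I_m) : Prop :=
  connected_graph e /\ unit_disk_graph R e.

(* What a processor receives in one time unit: [Some x] at j if it received the
   message x from processor j, and [None] at j if it received nothing from j. *)
Definition reception (M : Type) (m : nat) := {ffun 'I_m -> option M}.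

(* In [radio n m i s h] and [content n m i s h], i is the identity of the
   processor, s the number of time units since its own wake-up, and h the list,
   oldest first, of its receptions in the s time units since then. *)
Record algorithm := Algorithm {
  message : Type;
  radio : forall n m : nat, 'I_m -> nat -> seq (reception message m) -> bool;
  content : forall n m : nat, 'I_m -> nat -> seq (reception message m) -> message
}.

Section Execution.
Variables (A : algorithm) (n m : nat) (e : rel 'I_m) (wake : 'I_m -> 'I_n.+1).

Let histories := 'I_m -> seq (reception (message A) m).

Definition radio_on_with (h : histories) (t : nat) (i : 'I_m) : bool :=
  (wake i <= t)%N && @radio A n m i (t - wake i)%N (h i).

Definition received_with (h : histories) (t : nat) (i : 'I_m) :
    reception (message A) m :=
  [ffun j => if [&& e i j, radio_on_with h t i & radio_on_with h t j]
             then Some (@content A n m j (t - wake j)%N (h j)) else None].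

(* [history t i] holds the receptions of i in the global time units t' with
   wake i <= t' < t. *)
Fixpoint history (t : nat) : histories :=
  if t is t'.+1 then
    fun i => if (wake i <= t')%N
             then rcons (history t' i) (received_with (history t') t' i)
             else [::]
  else fun=> [::].

Definition radio_on (t : nat) (i : 'I_m) : bool := radio_on_with (history t) t i.

End Execution.

(* Beyond the common time unit with all radios on, nothing is asked about how
   the processors then set their clocks; any requirement of that kind only
   narrows the class of correct algorithms. *)
Definition correct_on (A : algorithm) (n m : nat) (e : rel 'I_m) : Prop :=
  forall wake : 'I_m -> 'I_n.+1,
    exists t : nat, forall i : 'I_m, radio_on A e wake t i.

Local Open Scope ereal_scope.

(* Extended-real valued, since a radio may be on infinitely often. *)
Definition radio_use (R : realType) (A : algorithm) (n m : nat) (e : rel 'I_m)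
    (wake : 'I_m -> 'I_n.+1) (i : 'I_m) : \bar R :=
  \sum_(0 <= t <oo) (radio_on A e wake t i)%:R%:E.

Definition total_radio_use (R : realType) (A : algorithm) (n m : nat)
    (e : rel 'I_m) (wake : 'I_m -> 'I_n.+1) : \bar R :=
  \sum_(i < m) radio_use R A e wake i.

Definition max_radio_use (R : realType) (A : algorithm) (n m : nat)
    (e : rel 'I_m) (wake : 'I_m -> 'I_n.+1) : \bar R :=
  ereal_sup [set radio_use R A e wake i | i in [set: 'I_m]].

Definition avg_radio_use (R : realType) (A : algorithm) (n m : nat)
    (e : rel 'I_m) (wake : 'I_m -> 'I_n.+1) : \bar R :=
  (m%:R^-1)%:E * total_radio_use R A e wake.

Definition worst_case_udg (R : realType) (n m : nat)
    (f : rel 'I_m -> ('I_m -> 'I_n.+1) -> \bar R) : \bar R :=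
  ereal_sup [set x | exists (e : rel 'I_m) (wake : 'I_m -> 'I_n.+1),
                       connected_udg R e /\ x = f e wake].

Definition max_efficiency (R : realType) (A : algorithm) (n m : nat) : \bar R :=
  @worst_case_udg R n m (fun e wake => max_radio_use R A e wake).

Definition avg_efficiency (R : realType) (A : algorithm) (n m : nat) : \bar R :=
  @worst_case_udg R n m (fun e wake => avg_radio_use R A e wake).

(* Main.v *)
(* On a path, choose the wake-up times independently and uniformly.  Until the
   first contact of a processor b with a neighbour, b follows its silent
   schedule, which depends only on its own wake-up time, and the other processors
   behave as if b were isolated, independently of that wake-up time.  So with
   K ~ sqrt n / 2, the first K on-times of b meet the first K on-times of a given
   neighbour for at most K^2 of the n + 1 wake-up times of b.  Hence on average at
   least half of the b have a first contact in which b or its neighbour is on for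
   more than the K-th time.  Each such heavy user accounts for at most three
   b, so some wake-up times give at least m / 6 heavy users. *)

Require Import Defs.
From mathcomp Require Import all_boot all_order all_algebra.
From mathcomp Require Import all_classical all_reals ereal topology normedtype sequences.
From mathcomp Require Import zify lra.

Set Implicit Arguments.
Unset Strict Implicit.
Unset Printing Implicit Defensive.

Import Order.TTheory GRing.Theory Num.Theory.
Local Open Scope ring_scope.

(** * Counting on-times *)

Definition on_count (f : nat -> bool) (t : nat) : nat := (\sum_(0 <= s < t) f s)%N.

Lemma on_countS (f : nat -> bool) (t : nat) : on_count f t.+1 = (on_count f t + f t)%N.
Proof. by rewrite /on_count big_nat_recr. Qed.

Lemma leq_on_count (f : nat -> bool) : {homo on_count f : s t / (s <= t)%N}.
Proof.
apply: homo_leq; first by [].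
- exact: leq_trans.
- by move=> t; rewrite on_countS leq_addr.
Qed.

Lemma eq_on_count (f g : nat -> bool) (t : nat) :
  (forall s, (s < t)%N -> f s = g s) -> on_count f t = on_count g t.
Proof. by move=> fg; apply: eq_big_nat => s /andP[_ /fg ->]. Qed.

Lemma on_count_inj (f : nat -> bool) (s t : nat) :
  f s -> f t -> on_count f s = on_count f t -> s = t.
Proof.
move=> fs ft; have lt u v : f u -> (u < v)%N -> (on_count f u < on_count f v)%N.
  by move=> fu /(@leq_on_count f); rewrite on_countS fu addn1.
by case: (ltngtP s t) => // [/(lt _ _ fs) | /(lt _ _ ft)] + E; rewrite E ltnn.
Qed.

Lemma on_count_shift (f : nat -> bool) (d t : nat) :
  on_count (fun s => (d <= s)%N && f (s - d)%N) t = on_count f (t - d)%N.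
Proof.
elim: t => [|t IH]; first by rewrite sub0n /on_count !big_nil.
rewrite on_countS IH; case: leqP => [dt|td]; last first.
  by rewrite addn0 (eqP (ltnW td : _ - _ == 0)%N) (eqP (td : _ - _ == 0)%N).
by rewrite subSn // on_countS.
Qed.

(** If [X t] holds, [on_count X t] is the rank of t among the on-times of X, starting at 0. So the
    two bounds place t among the first K on-times of both schedules. *)
Definition early_meeting (X Y : nat -> bool) (K : nat) : Prop :=
  exists t, [/\ X t, Y t, (on_count X t < K)%N & (on_count Y t < K)%N].

(* An early meeting time t is determined by the rank of t in X, and t - d by its
   rank in S; hence d is determined by a pair of ranks below K. *)
Lemma card_early_meeting (X S : nat -> bool) (K n : nat) :
  (\sum_(d < n) `[< early_meeting X (fun s => (d <= s) && S (s - d)) K >] <= K * K)%N.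
Proof.
pose R (d : 'I_n) (p : 'I_K * 'I_K) := `[< exists t, [/\ (d <= t)%N, X t, S (t - d)%N,
  on_count X t = p.1 & on_count S (t - d)%N = p.2] >].
apply: (@leq_trans (\sum_(d < n) \sum_p R d p)%N).
  apply: leq_sum => d _; case: asboolP => // -[t [Xt /andP[dt St] cX]].
  rewrite on_count_shift => cS.
  rewrite (bigD1 (Ordinal cX, Ordinal cS)) //=; set b := R _ _.
  suff -> : b by [].
  by apply/asboolP; exists t.
rewrite exchange_big /=.
have -> : (K * K = \sum_(p : 'I_K * 'I_K) 1)%N by rewrite sum1_card card_prod card_ord.
apply: leq_sum => p _.
have [[d0 Rd0]|no] := pselect (exists d, R d p); last first.
  by rewrite big1 // => d _; case E: (R d p) => //; case: no; exists d.
rewrite (bigD1 d0) //= Rd0 big1 // => d dd0; case E: (R d p) => //; case/eqP: dd0.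
move/asboolP: E => [t [dt Xt St cX cS]]; move/asboolP: Rd0 => [u [du Xu Su cX' cS']].
have tu : t = u by apply: (@on_count_inj X) => //; rewrite cX.
have sd : (t - d = u - d0)%N by apply: (@on_count_inj S) => //; rewrite cS.
by apply: val_inj => /=; lia.
Qed.

(** * Isolating a processor *)

Definition isolate (m : nat) (b : 'I_m) (e : rel 'I_m) : rel 'I_m :=
  fun i j => [&& i != b, j != b & e i j].

Section Isolation.
Variables (A : algorithm) (n m : nat) (e : rel 'I_m) (b : 'I_m).
Implicit Types w : 'I_m -> 'I_n.+1.

(** The two executions can differ only through messages on edges at b. By induction they agree
    before time unit s, hence have the same radios on in s; by hypothesis no edge at b then has both
    ends on, so it carries nothing under [e] either. *)
Lemma history_isolate w t :
  symmetric e ->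
  (forall s a, (s < t)%N -> e b a ->
     ~~ (radio_on A (isolate b e) w s a && radio_on A (isolate b e) w s b)) ->
  forall i, history A e w t i = history A (isolate b e) w t i.
Proof.
move=> esym; elim: t => // t IH no i /=.
have {}IH := IH (fun s a st => no s a (ltnW st)).
case: ifP => // _; rewrite IH; congr rcons; apply/ffunP => j; rewrite !ffunE.
have E k : radio_on_with w (history A e w t) t k = radio_on A (isolate b e) w t k.
  by rewrite /radio_on /radio_on_with IH.
rewrite !E IH -!/(radio_on A (isolate b e) w t _) [isolate b e i j]/isolate.
have [->|_] /= := eqVneq i b.
  by case: ifP => // /and3P[/(no t _ (ltnSn t)) + B J]; rewrite B J.
have [->|_] //= := eqVneq j b.
by case: ifP => // /and3P[]; rewrite esym => /(no t _ (ltnSn t)) + B J; rewrite B J.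
Qed.

Lemma radio_on_isolate w t :
  symmetric e ->
  (forall s a, (s < t)%N -> e b a ->
     ~~ (radio_on A (isolate b e) w s a && radio_on A (isolate b e) w s b)) ->
  forall i, radio_on A e w t i = radio_on A (isolate b e) w t i.
Proof.
by move=> es no i; rewrite /radio_on /radio_on_with (history_isolate es no).
Qed.

(** No message leaves b once it is isolated, so the other processors cannot notice when it wakes
    up. *)
Lemma history_isolate_wake w w' :
  (forall i, i != b -> w i = w' i) ->
  forall t i, i != b -> history A (isolate b e) w t i = history A (isolate b e) w' t i.
Proof.
move=> ww'; elim=> // t IH i ib /=; rewrite ww' //.
case: ifP => // _; rewrite IH //; congr rcons; apply/ffunP => j; rewrite !ffunE.
rewrite /isolate ib; have [//|jb] /= := eqVneq j b.
by rewrite /radio_on_with !IH // !ww'.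
Qed.

Lemma radio_on_isolate_wake w w' t i :
  (forall i, i != b -> w i = w' i) -> i != b ->
  radio_on A (isolate b e) w t i = radio_on A (isolate b e) w' t i.
Proof.
by move=> ww' ib; rewrite /radio_on /radio_on_with (history_isolate_wake ww') // ww'.
Qed.

Definition silent_schedule (s : nat) : bool :=
  @radio A n m b s (nseq s [ffun=> None]).

Lemma history_isolate_self w t :
  history A (isolate b e) w t b = nseq (t - w b) [ffun=> None].
Proof.
elim: t => [|t IH] //=; case: leqP => [wt|tw]; last by rewrite (eqP (tw : _ - _ == 0)%N).
rewrite subSn // -addn1 nseqD IH cats1; congr rcons.
by apply/ffunP => j; rewrite !ffunE /isolate eqxx.
Qed.

Lemma radio_on_isolate_self w t :
  radio_on A (isolate b e) w t b = (w b <= t)%N && silent_schedule (t - w b).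
Proof. by rewrite /radio_on /radio_on_with history_isolate_self. Qed.

End Isolation.

(** * First contact with a neighbour *)

Definition early_contact (A : algorithm) (n m : nat) (e : rel 'I_m) (K : nat)
    (b : 'I_m) (w : 'I_m -> 'I_n.+1) : Prop :=
  exists2 a, e b a &
    early_meeting ((radio_on A (isolate b e) w)^~ a) ((radio_on A (isolate b e) w)^~ b) K.

Lemma late_contact_use (A : algorithm) (n m : nat) (e : rel 'I_m) (K : nat)
    (b : 'I_m) (w : 'I_m -> 'I_n.+1) :
  symmetric e -> (exists a, e b a) -> correct_on A n e -> ~ early_contact A e K b w ->
  exists2 a, (a == b) || e b a &
    exists t, (K < on_count ((radio_on A e w)^~ a) t)%N.
Proof.
move=> esym [a0 ba0] /(_ w) [T allon] late.
pose contact t := [exists a, [&& e b a, radio_on A (isolate b e) w t a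
                               & radio_on A (isolate b e) w t b]].
(* Without any contact both executions agree at T, where correctness has b and [a0] on together: a
   contact after all. *)
have con : exists t, contact t.
  apply: contrapT => no.
  have no' s a : (s < T)%N -> e b a ->
     ~~ (radio_on A (isolate b e) w s a && radio_on A (isolate b e) w s b).
    by move=> _ ba; apply/negP => c; apply: no; exists s; apply/existsP; exists a; rewrite ba.
  apply: no; exists T; apply/existsP; exists a0.
  by rewrite ba0 -!(radio_on_isolate esym no') !allon.
case: (ex_minnP con) => t tcon tmin.
(* Agreement includes the first contact time t itself, since what is received in t influences only
   later time units. *)
have agree s i : (s <= t)%N -> radio_on A e w s i = radio_on A (isolate b e) w s i.
  move=> st; apply: radio_on_isolate => // u a us ba.
  apply/negP => c; suff /tmin : contact u by lia.
  by apply/existsP; exists a; rewrite ba.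
case/existsP: tcon => a /and3P[ba at_ bt].
have use i : radio_on A (isolate b e) w t i ->
    (K <= on_count ((radio_on A (isolate b e) w)^~ i) t)%N ->
    exists t, (K < on_count ((radio_on A e w)^~ i) t)%N.
  (* At least K on-times precede t, and t is one more; this gives the strict inequality. *)
  move=> it Kt; exists t.+1; rewrite on_countS agree // it addn1 ltnS.
  by rewrite (@eq_on_count _ ((radio_on A (isolate b e) w)^~ i)) // => s /ltnW /agree.
have [Ka|Ka] := leqP K (on_count ((radio_on A (isolate b e) w)^~ a) t).
  by exists a; [rewrite ba orbT | exact: use].
have [Kb|Kb] := leqP K (on_count ((radio_on A (isolate b e) w)^~ b) t).
  by exists b; [rewrite eqxx | exact: use].
by case: late; exists a => //; exists t.
Qed.

(** * Averaging over wake-up times *)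

Definition set_wake (n m : nat) (b : 'I_m) (w : {ffun 'I_m -> 'I_n.+1}) (d : 'I_n.+1) :
    {ffun 'I_m -> 'I_n.+1} :=
  [ffun i => if i == b then d else w i].

(** With b isolated, changing d leaves the schedule of each neighbour fixed and only shifts the
    silent schedule of b. So [card_early_meeting] applies to each neighbour, and a union bound
    finishes. *)
Lemma sum_early_contact (A : algorithm) (n m : nat) (e : rel 'I_m) (K : nat)
    (b : 'I_m) (w : {ffun 'I_m -> 'I_n.+1}) :
  irreflexive e ->
  (\sum_(d < n.+1) `[< early_contact A e K b (set_wake b w d) >] <= #|e b| * (K * K))%N.
Proof.
move=> eirr.
apply: (@leq_trans (\sum_(d < n.+1) \sum_(a | e b a)
   `[< early_meeting ((radio_on A (isolate b e) w)^~ a)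
        (fun s => (d <= s)%N && silent_schedule A n b (s - d)) K >])).
  apply: leq_sum => d _; case: asboolP => // -[a ba em].
  rewrite (bigD1 a) //=; set x := asbool _; suff -> : x by [].
  apply/asboolP; move: em.
  have -> : (radio_on A (isolate b e) (set_wake b w d))^~ a = (radio_on A (isolate b e) w)^~ a.
    apply/funext => s; apply: radio_on_isolate_wake.
      by move=> i /negPf ib; rewrite ffunE ib.
    by apply/eqP => ab; rewrite ab eirr in ba.
  suff -> : (radio_on A (isolate b e) (set_wake b w d))^~ b =
            (fun s => (d <= s)%N && silent_schedule A n b (s - d)) by [].
  by apply/funext => s; rewrite radio_on_isolate_self ffunE eqxx.
rewrite exchange_big /= -sum_nat_const.
by apply: leq_sum => a _; exact: card_early_meeting.
Qed.

(* Swapping w b with d is an involution of the pairs (w, d). *)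
Lemma sum_set_wake (n m : nat) (b : 'I_m) (F : {ffun 'I_m -> 'I_n.+1} -> nat) :
  (\sum_w \sum_(d < n.+1) F (set_wake b w d) = n.+1 * \sum_w F w)%N.
Proof.
pose swap (p : {ffun 'I_m -> 'I_n.+1} * 'I_n.+1) := (set_wake b p.1 p.2, p.1 b).
have swapK : involutive swap.
  case=> w d; rewrite /swap /= ffunE eqxx; congr pair; apply/ffunP => i.
  by rewrite !ffunE; case: eqP => // ->.
rewrite pair_big /= (reindex_inj (inv_inj swapK)) /=.
rewrite (eq_bigr (fun p => F p.1)); last by move=> p _; rewrite -[in RHS](swapK p).
rewrite -(pair_big xpredT xpredT (fun w _ => F w)) /= exchange_big /=.
by rewrite sum_nat_const card_ord.
Qed.

Lemma many_heavy_users (A : algorithm) (n m : nat) (e : rel 'I_m) (D K : nat) :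
  symmetric e -> irreflexive e -> (forall b, 0 < #|e b| <= D)%N -> correct_on A n e ->
  (2 * D * (K * K) <= n.+1)%N ->
  exists (w : 'I_m -> 'I_n.+1) (P : {set 'I_m}), (m <= 2 * D.+1 * #|P|)%N /\
    forall i, i \in P -> exists t, (K < on_count ((radio_on A e w)^~ i) t)%N.
Proof.
move=> esym eirr edeg corr DK.
pose bad b (w : {ffun 'I_m -> 'I_n.+1}) := `[< early_contact A e K b w >].
have [w fewbad] : exists w, (2 * \sum_b bad b w <= m)%N.
  apply: contrapT => /forallNP no.
  (* For each b, the sum over w is averaged over the wake-up time of b alone by [sum_set_wake]. *)
  have tot : (n.+1 * \sum_w \sum_b bad b w
              <= m * (#|{ffun 'I_m -> 'I_n.+1}| * (D * (K * K))))%N.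
    rewrite exchange_big big_distrr /= -[X in (_ <= X * _)%N]card_ord -sum_nat_const.
    apply: leq_sum => b _; rewrite -(sum_set_wake b) -sum_nat_const.
    apply: leq_sum => w _; apply: leq_trans (sum_early_contact _ _ _ _ eirr) _.
    by rewrite leq_mul2r; case/andP: (edeg b) => _ ->; rewrite orbT.
  (* If every w has more than m / 2 bad processors, the excess contradicts [tot], since [DK] makes
     the average at most m / 2. *)
  have low : (#|{ffun 'I_m -> 'I_n.+1}| * m.+1 <= 2 * \sum_w \sum_b bad b w)%N.
    rewrite big_distrr /= -sum_nat_const; apply: leq_sum => w _.
    by rewrite ltnNge; apply/negP/no.
  have N0 : (0 < #|{ffun 'I_m -> 'I_n.+1}|)%N.
    by apply/card_gt0P; exists [ffun=> ord0].
  move: tot low N0; set N := #|_|; set S := (\sum_w _)%N => tot low N0.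
  have := leq_mul (leqnn n.+1) low.
  have : (2 * (m * (N * (D * (K * K)))) <= m * N * n.+1)%N.
    by apply: leq_trans (leq_mul (leqnn (m * N)) DK); nia.
  nia.
pose P := [set i | `[< exists t, (K < on_count ((radio_on A e w)^~ i) t)%N >]].
exists w, P; split; last by move=> i; rewrite inE => /asboolP.
(* Each b that is not bad has a heavy user in its closed neighbourhood; conversely a heavy user lies
   in at most D + 1 closed neighbourhoods. *)
have good : (m - \sum_b bad b w <= D.+1 * #|P|)%N.
  apply: (@leq_trans (\sum_b ((b \in P) + \sum_(a | e b a) (a \in P)))%N).
    rewrite leq_subLR -big_split /= -[X in (X <= _)%N]card_ord -sum1_card.
    apply: leq_sum => b _; rewrite /bad; case: asboolP => // nb.
    have nbr : exists a, e b a by case/andP: (edeg b) => /card_gt0P[a ?] _; exists a.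
    have [a + heavy] := late_contact_use esym nbr corr nb.
    have aP : a \in P by rewrite inE; apply/asboolP.
    case/orP=> [/eqP <-|ba]; first by rewrite aP.
    by rewrite (bigD1 a) //= aP; lia.
  have cardP : (#|P| = \sum_i (i \in P))%N by rewrite -sum1_card big_mkcond.
  rewrite big_split /= mulSn -cardP leq_add2l cardP.
  rewrite (exchange_big_dep xpredT) //= mulnC.
  rewrite [X in (X <= _)%N](eq_bigr (fun a => (#|e a| * (a \in P))%N)); last first.
    by move=> a _; rewrite sum_nat_const; congr (_ * _)%N; apply: eq_card => b; rewrite unfold_in /= esym.
  rewrite big_distrl /=; apply: leq_sum => a _.
  by case: (a \in P); rewrite ?muln0 // muln1 mul1n; case/andP: (edeg a).
by rewrite -mulnA; move: (\sum_b _)%N (D.+1 * _)%N fewbad good => B Q; lia.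
Qed.

(** * Paths as unit disk graphs *)

Definition path_graph (m : nat) : rel 'I_m :=
  fun i j => (i.+1 == j :> nat) || (j.+1 == i :> nat).

Lemma path_graph_sym (m : nat) : symmetric (@path_graph m).
Proof. by move=> i j; rewrite /path_graph orbC. Qed.

Lemma path_graph_irr (m : nat) : irreflexive (@path_graph m).
Proof. by move=> i; rewrite /path_graph; lia. Qed.

Lemma path_graph_degree (m : nat) (b : 'I_m) :
  (2 <= m)%N -> (0 < #|path_graph b| <= 2)%N.
Proof.
case: m b => [|m] b m2; first by case: b.
apply/andP; split.
  apply/card_gt0P; have [bm|mb] := ltnP b m.
    by exists (inord b.+1); rewrite unfold_in /path_graph inordK // eqxx.
  have b1 : (b.-1 < m.+1)%N by case: b {mb} => -[|b] //= /ltnW.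
  have b0 : (0 < b)%N by apply: leq_trans mb.
  by exists (inord b.-1); rewrite unfold_in /path_graph inordK // prednK // eqxx orbT.
(* At an end of the path one entry is not a neighbour of b ([inord] may return a default); only the
   inclusion of the neighbours is needed. *)
apply: (@leq_trans #|[:: (inord b.+1 : 'I_m.+1); inord b.-1]|); last exact: card_size.
apply: subset_leq_card; apply/fintype.subsetP => j; rewrite unfold_in !inE => /orP[]/eqP E.
  by apply/orP; left; rewrite E inord_val.
by apply/orP; right; rewrite -E inord_val.
Qed.

Lemma path_graph_connected_udg (R : realType) (m : nat) :
  connected_udg R (@path_graph m).
Proof.
split.
  case: m => [[]//|m] i j.
  have c0 k : (k <= m)%N -> connect (@path_graph m.+1) ord0 (inord k).
    elim: k => [|k IH] km; first by rewrite (_ : inord 0 = ord0) //; apply/val_inj; rewrite /= inordK.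
    apply: connect_trans (IH (ltnW km)) (connect1 _).
    by rewrite /path_graph !inordK ?eqxx // ltnW.
  have c i' : connect (@path_graph m.+1) ord0 i' by rewrite -(inord_val i') c0 // -ltnS.
  by apply: connect_trans (c j); rewrite (sym_connect_sym (@path_graph_sym _)).
(* Integer points on a line with radius 1: distinct i and j are within range exactly when they are
   consecutive. *)
exists 1, (fun i => (i%:R, 0)); split => // i j.
rewrite /euclidean_dist /= subr0 expr0n addr0 sqrtr_sqr /path_graph.
rewrite -val_eqE /= -[(i : nat)%:R]/((i : nat)%:Z%:~R) -[(j : nat)%:R]/((j : nat)%:Z%:~R).
rewrite -intrB -intr_norm -[1]/(1%:~R) ler_int; lia.
Qed.

(** * Radio use and the final bound *)

Lemma radio_use_ge (R : realType) (A : algorithm) (n m : nat) (e : rel 'I_m)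
    (w : 'I_m -> 'I_n.+1) (i : 'I_m) (t : nat) :
  ((on_count ((radio_on A e w)^~ i) t)%:R%:E <= radio_use R A e w i)%E.
Proof.
rewrite /on_count natr_sum -sumEFin; apply: nneseries_lim_ge => s _ _.
by rewrite lee_fin.
Qed.

Lemma radio_use_ge0 (R : realType) (A : algorithm) (n m : nat) (e : rel 'I_m)
    (w : 'I_m -> 'I_n.+1) (i : 'I_m) : (0 <= radio_use R A e w i)%E.
Proof. by apply: nneseries_ge0 => s _ _; rewrite lee_fin. Qed.

Theorem lemma4p4 (R : realType) :
  exists c : R, 0 < c /\
    forall m n : nat, (2 <= m)%N -> (1 <= n)%N ->
    forall A : algorithm,
      (forall e : rel 'I_m, connected_udg R e -> correct_on A n e) ->
      (exists (e : rel 'I_m) (wake : 'I_m -> 'I_n.+1),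
          connected_udg R e /\
          ((c * m%:R * Num.sqrt n%:R)%:E <= total_radio_use R A e wake)%E) /\
      ((c * Num.sqrt n%:R)%:E <= max_efficiency R A n m)%E /\
      ((c * Num.sqrt n%:R)%:E <= avg_efficiency R A n m)%E.
Proof.
(* At least m / 6 heavy users, each on at least K + 1 >= sqrt n / 2 times, give the factor 1 /
   12. *)
exists 12^-1; split => // m n m2 _ A corr.
have udg := path_graph_connected_udg R m.
(* K is the largest integer with 4 K^2 <= n + 1, the condition of [many_heavy_users] for degree
   bound D = 2; it is 0 for small n. *)
have [K K1 K2] : exists2 K, (4 * (K * K) <= n.+1)%N & (n.+1 < 4 * (K.+1 * K.+1))%N.
  have P0 : exists K, (n.+1 < 4 * (K.+1 * K.+1))%N by exists n; nia.
  case: (ex_minnP P0) => -[|K] HK Kmin; first by exists 0%N.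
  by exists K.+1 => //; rewrite leqNgt; apply/negP => /Kmin; rewrite ltnn.
have [w [P [mP heavy]]] := @many_heavy_users A n m (@path_graph m) 2 K
  (@path_graph_sym m) (@path_graph_irr m) (fun b => path_graph_degree b m2) (corr _ udg) K1.
have sqrtK : Num.sqrt (n%:R : R) <= 2 * K.+1%:R.
  rewrite -[leRHS]ger0_norm ?mulr_ge0 // -sqrtr_sqr ler_wsqrtr //.
  rewrite -natrM -natrX ler_nat; nia.
have use i : i \in P -> (K.+1%:R%:E <= radio_use R A (@path_graph m) w i)%E.
  by case/heavy => t Kt; apply: le_trans (radio_use_ge _ _ _ _ _ t); rewrite lee_fin ler_nat.
have total : ((12^-1 * m%:R * Num.sqrt n%:R)%:E <= total_radio_use R A (@path_graph m) w)%E.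
  apply: (@le_trans _ _ (\sum_(i in P) K.+1%:R%:E)%E).
    rewrite sumEFin lee_fin sumr_const.
    have mP' : (m%:R : R) <= 6 * #|P|%:R by rewrite -natrM ler_nat.
    rewrite -[leRHS]mulr_natr.
    have := ler_pM (ler0n R m) (sqrtr_ge0 _) mP' sqrtK; lra.
  rewrite big_mkcond /=; apply: lee_sum => i _.
  by case: ifP => [/use //|_]; exact: radio_use_ge0.
split; first by exists (@path_graph m), w.
split.
  have [i iP] : exists i, i \in P by apply/card_gt0P; lia.
  apply: (@le_trans _ _ (max_radio_use R A (@path_graph m) w)); last first.
    by apply: ereal_sup_ubound; exists (@path_graph m), w.
  apply: (@le_trans _ _ (radio_use R A (@path_graph m) w i)); last first.
    by apply: ereal_sup_ubound; exists i.
  apply: le_trans (use i iP); rewrite lee_fin.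
  have := sqrtr_ge0 (n%:R : R); lra.
apply: (@le_trans _ _ (avg_radio_use R A (@path_graph m) w)); last first.
  by apply: ereal_sup_ubound; exists (@path_graph m), w.
have m0 : 0 < (m%:R : R) by rewrite ltr0n; lia.
apply: le_trans (lee_wpmul2l _ total); last by rewrite lee_fin invr_ge0 ltW.
rewrite -EFinM lee_fin [12^-1 * _]mulrC -!mulrA mulKf // gt_eqF //.
Qed.
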